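(* Let $\mathbb{K}$ be a field, $X$ a non-empty set, $R\subseteq \mathbb{K}\langle X\rangle$, $A=\mathbb{K}\langle X\rangle/I(R)$ an algebra augmented by $\varepsilon: A\to\mathbb{K}$, and $\prec$ a monomial order on $\langle X\rangle$. Let $M$ be the set of normal words. Then $$M=\langle X\rangle\setminus \mathrm{LM}(I(R)).$$ As a consequence, there is a direct sum decomposition of $\mathbb{K}$-vector spaces $$\mathbb{K}\langle X\rangle = I(R)\oplus \mathbb{K}M.$$
   Context: $\langle X\rangle$ is the free monoid on $X$ (words on the alphabet $X$, with empty word $1$), and $\mathbb{K}\langle X\rangle$ is the free associative unitary $\mathbb{K}$-algebra on $X$ (non-commutative polynomials), which has $\langle X\rangle$ as a $\mathbb{K}$-basis. $I(R)$ is the two-sided ideal of $\mathbb{K}\langle X\rangle$ generated by $R$. For $g\in\mathbb{K}\langle X\rangle$, $\overline{g}$ denotes its image in $A=\mathbb{K}\langle X\rangle/I(R)$. The augmentation $\varepsilon:A\to\mathbb{K}$ is a surjective homomorphism of $\mathbb{K}$-algebras. A monomial order $\prec$ is a (total) well-order on $\langle X\rangle$ compatible with left and right multiplication: $u\prec v$ implies $wuw'\prec wvw'$ for all words $w,w'$. For a nonzero polynomial $f$, $\mathrm{LM}(f)$ is the $\prec$-greatest word appearing in $f$ with nonzero coefficient; for a set $F$ of polynomials, $\mathrm{LM}(F)=\{\mathrm{LM}(f) : f\in F,\ f\neq 0\}$. The set of normal words is $$M=\Big\{w\in\langle X\rangle : \text{for all } n \text{ and all } w_1,\dots,w_n\in\langle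 X\rangle \text{ with every } w_i\prec w, \text{ and all } \lambda_1,\dots,\lambda_n\in\mathbb{K},\ \overline{w}\neq\sum_{i=1}^n\lambda_i\overline{w_i}\Big\}.$$ $\mathbb{K}M$ denotes the $\mathbb{K}$-linear span of $M$ in $\mathbb{K}\langle X\rangle$. *)

(* Defs.v *)
From HB Require Import structures.
From mathcomp Require Import all_boot all_order all_algebra.
From mathcomp Require Import generic_quotient.
From mathcomp Require Import finmap.
From mathcomp Require Import boolp classical_sets.
From mathcomp Require wochoice.
From mathcomp.multinomials Require Import monalg.

Set Implicit Arguments.
Unset Strict Implicit.
Unset Printing Implicit Defensive.

Import GRing.Theory.
Local Open Scope ring_scope.
Local Open Scope quotient_scope.
Local Open Scope classical_set_scope.

Section Subspaces.
Variables (K : fieldType) (V : lmodType K).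
Implicit Types U W S : set V.

Definition linear_subspace U : Prop :=
  U 0 /\ (forall (a : K) (u v : V), U u -> U v -> U (a *: u + v)).

Definition linear_span S : set V := smallest linear_subspace S.

(* internal direct sum: the whole of V is U (+) W *)
Definition direct_sum U W : Prop :=
  [/\ linear_subspace U, linear_subspace W,
      (forall f : V, exists u v, [/\ U u, W v & f = u + v]) &
      U `&` W = [set 0]].

End Subspaces.

(* Quotient of an algebra by the two-sided ideal generated by a set. B is only
   a lalgType because that is what monalg provides over a non-commutative
   monoid. The quotient is a pzRingType and a lmodType, with quot_scaleAl as a
   lemma: it is trivial when R generates the unit ideal, whereas the library's
   lalgType and algType are non-trivial rings. *)
Section Ideals.
Variables (K : fieldType) (B : lalgType K).
Implicit Types I R : set B.

Definition two_sided_ideal I : Prop :=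
  [/\ I 0,
      (forall u v, I u -> I v -> I (u - v)),
      (forall b u, I u -> I (b * u)) &
      (forall u b, I u -> I (u * b))].

Definition ideal_gen R : set B := smallest two_sided_ideal R.

Lemma ideal_two_sided R : two_sided_ideal (ideal_gen R).
Proof.
split; first by move=> J [[]].
- move=> u v Iu Iv J JR; case: (JR) => -[_ JB _ _] _.
  exact: JB (Iu J JR) (Iv J JR).
- by move=> b u Iu J JR; case: (JR) => -[_ _ Jl _] _; exact: Jl (Iu J JR).
- by move=> u b Iu J JR; case: (JR) => -[_ _ _ Jr] _; exact: Jr (Iu J JR).
Qed.

Variable R : set B.

Let I0 : ideal_gen R 0. Proof. by case: (ideal_two_sided R). Qed.
Let IB u v : ideal_gen R u -> ideal_gen R v -> ideal_gen R (u - v).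
Proof. by case: (ideal_two_sided R) => _ + _ _; apply. Qed.
Let Il b u : ideal_gen R u -> ideal_gen R (b * u).
Proof. by case: (ideal_two_sided R) => _ _ + _; apply. Qed.
Let Ir u b : ideal_gen R u -> ideal_gen R (u * b).
Proof. by case: (ideal_two_sided R) => _ _ _; apply. Qed.
Let IN u : ideal_gen R u -> ideal_gen R (- u).
Proof. by move=> Iu; rewrite -[- u]sub0r; exact: IB I0 Iu. Qed.
Let ID u v : ideal_gen R u -> ideal_gen R v -> ideal_gen R (u + v).
Proof. by move=> Iu Iv; rewrite -[v]opprK; exact: IB Iu (IN Iv). Qed.

Definition ideal_eq : rel B := fun f g => `[< ideal_gen R (f - g) >].

Lemma ideal_eq_refl : reflexive ideal_eq.
Proof. by move=> f; apply/asboolP; rewrite subrr; exact: I0. Qed.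
Lemma ideal_eq_sym : symmetric ideal_eq.
Proof.
by move=> f g; apply/asboolP/asboolP => /IN; rewrite opprB.
Qed.
Lemma ideal_eq_trans : transitive ideal_eq.
Proof.
move=> g f h /asboolP fg /asboolP gh; apply/asboolP.
by rewrite -[f](subrK g) -addrA; exact: ID fg gh.
Qed.

Canonical ideal_equiv :=
  EquivRel ideal_eq ideal_eq_refl ideal_eq_sym ideal_eq_trans.

Definition quotAlg : Type := {eq_quot ideal_equiv}.
HB.instance Definition _ := Choice.on quotAlg.
HB.instance Definition _ := EqQuotient.on quotAlg.

Definition quot_map (f : B) : quotAlg := \pi_quotAlg f.

Lemma quot_mapP f g : quot_map f = quot_map g <-> ideal_gen R (f - g).
Proof.
split; first by move/eqmodP => /asboolP.
by move=> Ifg; apply/eqmodP/asboolP.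
Qed.

Lemma quot_map_surj (a : quotAlg) : exists f, quot_map f = a.
Proof. by exists (repr a); rewrite /quot_map reprK. Qed.

Let lift f : ideal_gen R (repr (quot_map f) - f).
Proof. by apply/quot_mapP; rewrite /quot_map reprK. Qed.

Definition quot_add (a b : quotAlg) : quotAlg := quot_map (repr a + repr b).
Definition quot_opp (a : quotAlg) : quotAlg := quot_map (- repr a).
Definition quot_mul (a b : quotAlg) : quotAlg := quot_map (repr a * repr b).
Definition quot_scale (c : K) (a : quotAlg) : quotAlg := quot_map (c *: repr a).

Lemma quot_addE f g : quot_add (quot_map f) (quot_map g) = quot_map (f + g).
Proof. by apply/quot_mapP; rewrite opprD addrACA; exact: ID (lift f) (lift g). Qed.
Lemma quot_oppE f : quot_opp (quot_map f) = quot_map (- f).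
Proof. by apply/quot_mapP; rewrite -opprD; exact: IN (lift f). Qed.
Lemma quot_mulE f g : quot_mul (quot_map f) (quot_map g) = quot_map (f * g).
Proof.
apply/quot_mapP; set f' := repr _; set g' := repr _.
have -> : f' * g' - f * g = f' * (g' - g) + (f' - f) * g.
  by rewrite mulrBr mulrBl addrA subrK.
exact: ID (Il _ (lift g)) (Ir _ (lift f)).
Qed.
Lemma quot_scaleE c f : quot_scale c (quot_map f) = quot_map (c *: f).
Proof.
by apply/quot_mapP; rewrite -scalerBr -mulr_algl; exact: Il (lift f).
Qed.

Let quotE := (quot_addE, quot_oppE, quot_mulE, quot_scaleE).
Local Ltac quot_elim a := let f := fresh in case: (quot_map_surj a) => f <-.

Fact quot_addA : associative quot_add.
Proof.
by move=> a b c; quot_elim a; quot_elim b; quot_elim c; rewrite !quotE addrA.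
Qed.
Fact quot_addC : commutative quot_add.
Proof. by move=> a b; quot_elim a; quot_elim b; rewrite !quotE addrC. Qed.
Fact quot_add0 : left_id (quot_map 0) quot_add.
Proof. by move=> a; quot_elim a; rewrite !quotE add0r. Qed.
Fact quot_addN : left_inverse (quot_map 0) quot_opp quot_add.
Proof. by move=> a; quot_elim a; rewrite !quotE addNr. Qed.

HB.instance Definition _ :=
  GRing.isZmodule.Build quotAlg quot_addA quot_addC quot_add0 quot_addN.

Fact quot_mulA : associative quot_mul.
Proof.
by move=> a b c; quot_elim a; quot_elim b; quot_elim c; rewrite !quotE mulrA.
Qed.
Fact quot_mul1 : left_id (quot_map 1) quot_mul.
Proof. by move=> a; quot_elim a; rewrite !quotE mul1r. Qed.
Fact quot_mulr1 : right_id (quot_map 1) quot_mul.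
Proof. by move=> a; quot_elim a; rewrite !quotE mulr1. Qed.
Fact quot_mulDl : left_distributive quot_mul quot_add.
Proof.
by move=> a b c; quot_elim a; quot_elim b; quot_elim c; rewrite !quotE mulrDl.
Qed.
Fact quot_mulDr : right_distributive quot_mul quot_add.
Proof.
by move=> a b c; quot_elim a; quot_elim b; quot_elim c; rewrite !quotE mulrDr.
Qed.

HB.instance Definition _ := GRing.Zmodule_isPzRing.Build quotAlg
  quot_mulA quot_mul1 quot_mulr1 quot_mulDl quot_mulDr.

Fact quot_scaleA c d a :
  quot_scale c (quot_scale d a) = quot_scale (c * d) a.
Proof. by quot_elim a; rewrite !quotE scalerA. Qed.
Fact quot_scale1 : left_id 1 quot_scale.
Proof. by move=> a; quot_elim a; rewrite !quotE scale1r. Qed.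
Fact quot_scaleDr : right_distributive quot_scale +%R.
Proof.
move=> c a b; quot_elim a; quot_elim b.
by rewrite -[_ + _ in LHS]/(quot_add _ _) -[RHS]/(quot_add _ _) !quotE scalerDr.
Qed.
Fact quot_scaleDl a : {morph quot_scale^~ a : c d / c + d}.
Proof.
by move=> c d; quot_elim a; rewrite -[RHS]/(quot_add _ _) !quotE scalerDl.
Qed.

HB.instance Definition _ := GRing.Zmodule_isLmodule.Build K quotAlg
  quot_scaleA quot_scale1 quot_scaleDr quot_scaleDl.

Fact quot_scaleAl (c : K) (a b : quotAlg) : c *: (a * b) = (c *: a) * b.
Proof.
quot_elim a; quot_elim b.
rewrite -[LHS]/(quot_scale _ (quot_mul _ _)) -[RHS]/(quot_mul (quot_scale _ _) _).
by rewrite !quotE scalerAl.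
Qed.

Fact quot_map_zmod : zmod_morphism quot_map.
Proof.
move=> f g; rewrite -[RHS]/(quot_add _ (quot_opp _)).
by rewrite quot_oppE quot_addE.
Qed.
Fact quot_map_monoid : monoid_morphism quot_map.
Proof. by split=> // f g; rewrite -[RHS]/(quot_mul _ _) quot_mulE. Qed.
Fact quot_map_scalable : scalable quot_map.
Proof. by move=> c f; rewrite -[RHS]/(quot_scale _ _) quot_scaleE. Qed.

HB.instance Definition _ :=
  GRing.isZmodMorphism.Build B quotAlg quot_map quot_map_zmod.
HB.instance Definition _ :=
  GRing.isMonoidMorphism.Build B quotAlg quot_map quot_map_monoid.
HB.instance Definition _ :=
  GRing.isScalable.Build K B quotAlg *:%R quot_map quot_map_scalable.

End Ideals.

(* Words on X are {fmonom X} (lists of letters, with concatenation), and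
   non-commutative polynomials are {malg K[{fmonom X}]}: finitely supported
   functions on words; << w >> is the polynomial reduced to the word w. *)
Section NormalWords.
Variables (K : fieldType) (X : choiceType).
Implicit Types (u v w : {fmonom X}) (f : {malg K[{fmonom X}]}).

(* lt is the strict relation; the well-order is its reflexive closure *)
Record monomial_order (lt : rel {fmonom X}) : Prop := MonomialOrder {
  mo_irr : irreflexive lt;
  mo_trans : transitive lt;
  mo_total : forall u v, u != v -> lt u v || lt v u;
  mo_wo : wochoice.well_order (fun u v => (u == v) || lt u v);
  mo_mul : forall u v w w',
    lt u v -> lt (mmul (mmul w u) w') (mmul (mmul w v) w')
}.

Variable lt : rel {fmonom X}.

Definition is_LM f w : Prop :=
  w \in msupp f /\ (forall v, v \in msupp f -> v != w -> lt v w).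

Definition LM (F : set {malg K[{fmonom X}]}) : set {fmonom X} :=
  [set w | exists f, [/\ F f, f != 0 & is_LM f w]].

Definition normal_words (R : set {malg K[{fmonom X}]}) : set {fmonom X} :=
  [set w | forall (n : nat) (w_ : 'I_n -> {fmonom X}) (lambda : 'I_n -> K),
     (forall i, lt (w_ i) w) ->
     quot_map R << w >> <> \sum_(i < n) lambda i *: quot_map R << w_ i >>].

End NormalWords.

(* Main.v *)
Require Import Defs.
From mathcomp Require Import all_boot all_order all_algebra.
From mathcomp Require Import finmap.
From mathcomp Require Import boolp classical_sets.
From mathcomp.multinomials Require Import monalg.

Set Implicit Arguments.
Unset Strict Implicit.
Unset Printing Implicit Defensive.

Local Open Scope ring_scope.
Local Open Scope classical_set_scope.

Import GRing.Theory.

(** The argument is linear algebra along the well-order on words.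

    An element f of the ideal with leading word w and leading coefficient c
    rewrites w: modulo the ideal, << w >> equals << w >> - c^-1 f, in which only
    words below w occur.  Conversely, if << w >> is congruent to a combination g
    of words below w, then << w >> - g lies in the ideal and its leading word is
    w.  Hence a word fails to be normal exactly when it is a leading word of the
    ideal ([normal_wordsE]).

    The decomposition holds for every linear subspace J in place of the ideal
    ([direct_sum_LM]).  Rewriting, by well-founded induction on words, brings each
    word, hence each polynomial, into J plus the span of the words outside LM(J).
    The sum is direct because a nonzero polynomial in the intersection would have
    a leading word, which would lie both inside and outside LM(J).

    Spans of sets of words are handled as spaces of polynomials with prescribed
    support ([linear_span_words]). *)

Section Subspaces.
Variables (K : fieldType) (V : lmodType K).
Implicit Types U W S : set V.

Lemma linear_subspaceZ U a u : linear_subspace U -> U u -> U (a *: u).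
Proof. by case=> U0 UD Uu; rewrite -[_ *: _]addr0; exact: UD. Qed.

Lemma linear_subspaceD U u v : linear_subspace U -> U u -> U v -> U (u + v).
Proof. by case=> _ UD Uu Uv; rewrite -[u]scale1r; exact: UD. Qed.

Lemma linear_subspace_sum U (I : eqType) (r : seq I) (F : I -> V) :
  linear_subspace U -> {in r, forall i, U (F i)} -> U (\sum_(i <- r) F i).
Proof.
move=> Usub UF; rewrite big_seq; elim/big_ind: _ => //; first by case: Usub.
by move=> u v; exact: linear_subspaceD.
Qed.

End Subspaces.

(** Scaling by a is left multiplication by a%:A, so ideals absorb it. *)
Lemma ideal_gen_subspace (K : fieldType) (B : lalgType K) (R : set B) :
  linear_subspace (ideal_gen R).
Proof.
have [I0 IB Il _] := ideal_two_sided R; split=> // a u v Iu Iv.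
rewrite -[v]opprK -mulr_algl; apply: (IB); first exact: Il.
by rewrite -sub0r; exact: IB.
Qed.

Section LeadingWords.
Variables (K : fieldType) (X : choiceType).
Implicit Types (u v w : {fmonom X}) (f g : {malg K[{fmonom X}]}).
Implicit Types (P : set {fmonom X}) (J : set {malg K[{fmonom X}]}).

Definition supported_in P : set {malg K[{fmonom X}]} :=
  [set f | forall w, w \in msupp f -> P w].

Lemma supported_in_subspace P : linear_subspace (supported_in P).
Proof.
split=> [w|a f g Pf Pg w]; first by rewrite msupp0.
move=> /(fsubsetP (msuppD_le _ _)); rewrite in_fsetU => /orP[|/Pg//].
by move/(fsubsetP (msuppZ_le _ _))/Pf.
Qed.

Lemma monalg_sumZ f : f = \sum_(w <- msupp f) f@_w *: << w >>.
Proof.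
rewrite {1}[f]monalgE; apply: eq_bigr => w _.
by apply/malgP => v; rewrite mcoeffZ !mcoeffU mulr_natr.
Qed.

(** Replaces the span, an intersection of subspaces, by a condition on supports
    that can be tested on each polynomial. *)
Lemma linear_span_words P :
  linear_span [set (<< w >> : {malg K[{fmonom X}]}) | w in P] = supported_in P.
Proof.
apply/seteqP; split=> f.
  apply; split; first exact: supported_in_subspace.
  by move=> _ [w Pw <-] v; rewrite msuppU1 in_fset1 => /eqP->.
move=> Pf U [Usub PU]; rewrite [f]monalg_sumZ.
apply: linear_subspace_sum => // w wf; apply: linear_subspaceZ => //.
by apply: PU; exists w => //; exact: Pf.
Qed.

Variable lt : rel {fmonom X}.
Hypothesis lt_mo : monomial_order lt.

Lemma monomial_order_ind (P : {fmonom X} -> Prop) :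
  (forall w, (forall v, lt v w -> P v) -> P w) -> forall w, P w.
Proof.
move=> IH; apply: contrapT => /existsNP[w0 nPw0].
have [|w [[]]] := mo_wo lt_mo (A := [pred w | `[< ~ P w >]]).
  by exists w0; apply/asboolP.
move=> /asboolP nPw w_min _; apply: nPw; apply: IH => v lt_vw.
apply: contrapT => nPv; have /w_min : v \in [pred w | `[< ~ P w >]].
  exact/asboolP.
case/predU1P=> [w_v|lt_wv]; first by rewrite w_v (mo_irr lt_mo) in lt_vw.
by have := mo_trans lt_mo lt_vw lt_wv; rewrite (mo_irr lt_mo).
Qed.

Lemma is_LM_exists f : f != 0 -> exists w, is_LM lt f w.
Proof.
rewrite -msupp_eq0; suff max (s : seq {fmonom X}) : s != [::] ->
    exists2 w, w \in s & {in s, forall v, v != w -> lt v w}.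
  move=> /fset0Pn[w wf]; have [|v vf vmax] := max (msupp f); last by exists v.
  apply: contraTneq wf => f0.
  by rewrite (_ : w \in msupp f = (w \in [::])) // -f0.
elim: s => // u [|u' s'] IHs _.
  by exists u; rewrite ?mem_head // => v; rewrite inE => ->.
move: (u' :: s') {IHs}(IHs isT) => s [w ws wmax].
have [lt_uw|nlt_uw] := boolP (lt u w).
  by exists w; rewrite ?inE ?ws ?orbT // => v /predU1P[->|/wmax].
exists u => [|v]; first exact: mem_head.
case/predU1P=> [->|vs vDu]; first by rewrite eqxx.
have [w_u|wDu] := eqVneq w u; first by rewrite -w_u wmax // w_u.
have lt_wu : lt w u by have:= mo_total lt_mo wDu; rewrite (negPf nlt_uw) orbF.
have [->//|vDw] := eqVneq v w.
exact: (mo_trans lt_mo) (wmax v vs vDw) lt_wu.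
Qed.

Lemma is_LM_tail f w : is_LM lt f w ->
  supported_in [set v | lt v w] (<< w >> - (f@_w)^-1 *: f).
Proof.
move=> [wf fmax] v; rewrite -mcoeff_neq0 mcoeffB mcoeffZ mcoeffU1.
have [<-|wDv] := eqVneq w v.
  by rewrite mulVf ?subrr ?eqxx // mcoeff_neq0.
rewrite sub0r oppr_eq0 mulf_eq0 negb_or mcoeff_neq0 => /andP[_ vf].
by apply: fmax; rewrite // eq_sym.
Qed.

Lemma is_LM_sub_lower g w : supported_in [set v | lt v w] g ->
  is_LM lt (<< w >> - g) w.
Proof.
move=> g_lt; have gw0 : g@_w = 0.
  apply: mcoeff_outdom; apply/negP => /g_lt /=.
  by rewrite (mo_irr lt_mo).
split=> [|v]; first by rewrite -mcoeff_neq0 mcoeffB gw0 subr0 mcoeffUU oner_eq0.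
move=> /(fsubsetP (msuppB_le _ _)); rewrite in_fsetU msuppU1 in_fset1.
by case/orP=> [->//|/g_lt].
Qed.

(** The rewriting step: leading words of J are those that J allows to be replaced
    by a combination of smaller words.  Dividing an element of J by its leading
    coefficient and dropping the leading word gives one direction; in the other,
    subtracting from << w >> smaller words leaves w leading. *)
Lemma LM_subspaceP J w : linear_subspace J ->
  LM lt J w <->
  exists2 g, supported_in [set v | lt v w] g & J (<< w >> - g).
Proof.
move=> Jsub; split=> [[f [Jf _ f_w]]|[g g_lt Jg]].
  exists (<< w >> - (f@_w)^-1 *: f); first exact: is_LM_tail.
  by rewrite opprB addrC subrK; exact: linear_subspaceZ.
have g_w := is_LM_sub_lower g_lt; exists (<< w >> - g); split=> //.
by apply: contraTneq g_w.1 => ->; rewrite msupp0.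
Qed.

Lemma direct_sum_LM J : linear_subspace J ->
  direct_sum J (supported_in (~` LM lt J)).
Proof.
move=> Jsub; set N := supported_in _.
have Nsub : linear_subspace N := supported_in_subspace _.
pose S := [set f | exists p q, [/\ J p, N q & f = p + q]].
have Ssub : linear_subspace S.
  split; first by exists 0, 0; rewrite addr0; case: Jsub Nsub => ? _ [].
  move=> a _ _ [p [q [Jp Nq ->]]] [p' [q' [Jp' Nq' ->]]].
  exists (a *: p + p'), (a *: q + q').
  by rewrite scalerDr addrACA; split=> //; [apply: Jsub.2 | apply: Nsub.2].
have JS f : J f -> S f by exists f, 0; rewrite addr0; split=> //; exact: Nsub.1.
have NS f : N f -> S f by exists 0, f; rewrite add0r; split=> //; exact: Jsub.1.
have S_sum (f : {malg K[{fmonom X}]}) :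
    {in msupp f, forall w, S << w >>} -> S f.
  move=> Sf; rewrite [f]monalg_sumZ; apply: linear_subspace_sum => // w wf.
  by apply: linear_subspaceZ => //; exact: Sf.
have S_word w : S << w >>.
  elim/monomial_order_ind: w => w IHw.
  have [/LM_subspaceP -/(_ Jsub)[g g_lt Jg]|nLMw] := pselect (LM lt J w).
    rewrite -(subrK g << w >>); apply: linear_subspaceD; [by []|exact: JS|].
    by apply: S_sum => v /g_lt/IHw.
  by apply: NS => v; rewrite msuppU1 in_fset1 => /eqP->.
split=> //; first by move=> f; apply: S_sum => w _; exact: S_word.
apply/seteqP; split=> [f [Jf Nf]|_ ->]; last by split; [case: Jsub | case: Nsub].
apply: contrapT => /eqP f_neq0; have [w f_w] := is_LM_exists f_neq0.
by apply: (Nf w f_w.1); exists f.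
Qed.

(** A finite family of words below w with coefficients, as in the definition of
    normal words, amounts to one polynomial supported below w. *)
Lemma normal_wordsE (R : set {malg K[{fmonom X}]}) :
  normal_words lt R = ~` LM lt (ideal_gen R).
Proof.
apply/seteqP; split=> w Mw; last first.
  move=> n w_ lambda w_lt ww_; apply: Mw.
  apply/(LM_subspaceP _ (ideal_gen_subspace R)).
  exists (\sum_(i < n) lambda i *: << w_ i >>).
    apply: linear_subspace_sum => [|i _]; first exact: supported_in_subspace.
    apply: (linear_subspaceZ _ (supported_in_subspace _)) => v.
    by rewrite msuppU1 in_fset1 => /eqP->; exact: w_lt.
  apply/quot_mapP; rewrite ww_ linear_sum.
  by apply: eq_bigr => i _; rewrite linearZ.
move=> /(LM_subspaceP _ (ideal_gen_subspace R))[g g_lt /quot_mapP wg].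
pose s : seq {fmonom X} := msupp g.
apply: (Mw (size s) (tnth (in_tuple s)) (fun i => g@_(tnth (in_tuple s) i))).
  by move=> i; apply: g_lt; exact: (mem_tnth i (in_tuple s)).
rewrite wg {1}[g]monalg_sumZ linear_sum big_tnth.
by apply: eq_bigr => i _; rewrite linearZ.
Qed.

End LeadingWords.

Theorem mainTheorem1 (K : fieldType) (X : choiceType)
    (X_nonempty : [set: X] !=set0)
    (R : set {malg K[{fmonom X}]})
    (eps : {rmorphism quotAlg R -> K})
    (eps_lin : forall (c : K) (a : quotAlg R), eps (c *: a) = c * eps a)
    (eps_surj : forall c : K, exists a, eps a = c)
    (lt : rel {fmonom X}) (lt_mo : monomial_order lt) :
  normal_words lt R = ~` LM lt (ideal_gen R) /\
  direct_sum (ideal_gen R)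
    (linear_span [set (<< w >> : {malg K[{fmonom X}]}) | w in normal_words lt R]).
Proof.
have normalE := normal_wordsE lt_mo R; split=> //.
rewrite linear_span_words normalE.
exact: direct_sum_LM (ideal_gen_subspace R).
Qed.
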